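(* Let $\Bbbk$ be an algebraically closed field of characteristic zero and let $\mathcal{K}$ be the $8$-dimensional non-semisimple non-pointed Hopf algebra over $\Bbbk$ described in the context. All partial actions of $\mathcal{K}$ on $\Bbbk$, namely $\varepsilon_{\mathcal{K}}$, $\lambda^0_{\{1,a^2\}}$, $\lambda_+$, $\lambda_-$ and $\lambda_\alpha$ for $\alpha\in\Bbbk$, are symmetric.
   Context: A partial action of a Hopf algebra $H$ on its base field $\Bbbk$ is a linear map $\lambda:H\to\Bbbk$ with $\lambda(1_H)=1$ and $\lambda(u)\lambda(v)=\lambda(u_1)\lambda(u_2v)$ for all $u,v\in H$ (Sweedler notation $\Delta(u)=u_1\otimes u_2$). It is symmetric if moreover $\lambda(u)\lambda(v)=\lambda(u_1v)\lambda(u_2)$ for all $u,v\in H$. Let $\xi\in\Bbbk$ be a primitive eighth root of unity, $q:=\xi^2$, $\sqrt2:=\frac{2\xi}{1+\xi^2}$. The Hopf algebra $\mathcal{K}$ is generated as an algebra by $a,b,c,d$ with relations $a^4=ad=da=1$, $b^2=c^2=bc=cb=0$, $a^2c=b$, $ab=q\,ba$, $ac=q\,ca$, $bd=q\,db$, $cd=q\,dc$. It has linear basis $\mathcal{B}_{\mathcal{K}}=\{1,a,b,c,d,a^2,ab,ac\}$. Coproduct: $\Delta(1)=1\otimes1$, $\Delta(a^2)=a^2\otimes a^2$, $\Delta(a)=a\otimes a+b\otimes c$, $\Delta(b)=b\otimes d+a\otimes b$, $\Delta(c)=c\otimes a+d\otimes c$, $\Delta(d)=c\otimes b+d\otimes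 d$, $\Delta(ab)=ab\otimes1+a^2\otimes ab$, $\Delta(ac)=ac\otimes a^2+1\otimes ac$. Counit: $\varepsilon(1)=\varepsilon(a)=\varepsilon(a^2)=\varepsilon(d)=1$, $\varepsilon(b)=\varepsilon(c)=\varepsilon(ab)=\varepsilon(ac)=0$. Antipode: $S(a)=d$, $S(b)=qb$, $S(c)=-qc$, $S(d)=a$. Linear maps $\mathcal{K}\to\Bbbk$: - $\lambda^0_{\{1,a^2\}}(t)=1$ if $t\in\{1,a^2\}$ and $0$ for the other $t\in\mathcal{B}_{\mathcal{K}}$; - for $\alpha\in\Bbbk$: $\lambda_\alpha(1)=1$, $\lambda_\alpha(ab)=\lambda_\alpha(ac)=\alpha$, $\lambda_\alpha(a^2)=\lambda_\alpha(a)=\lambda_\alpha(b)=\lambda_\alpha(c)=\lambda_\alpha(d)=0$; - $\lambda_\pm(1)=1$, $\lambda_\pm(a^2)=0$, $\lambda_\pm(a)=\frac{1-q}{2}$, $\lambda_\pm(d)=\frac{1+q}{2}$, $\lambda_\pm(b)=\lambda_\pm(c)=\lambda_\pm(ab)=\lambda_\pm(ac)=\pm\frac{\sqrt2}{2}$. These, together with $\varepsilon_{\mathcal{K}}$, are exactly the partial actions of $\mathcal{K}$ on $\Bbbk$. *)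

(* Defs.v *)
From HB Require Import structures.
From mathcomp Require Import all_boot all_order all_algebra all_field.

Set Implicit Arguments.
Unset Strict Implicit.
Unset Printing Implicit Defensive.

Import GRing.Theory.

Local Open Scope ring_scope.

(* The tensor product U (x) V of two finite-dimensional spaces is realised as
   the space of coordinate matrices in the bases vbasis {:U} and vbasis {:V}.
   [tens u v] is the pure tensor u (x) v, and [tlift f] sends a tensor
   t = sum u_1 (x) u_2 to sum f u_1 u_2 when f is bilinear (lemma
   [tlift_tens]), so that Sweedler's  f(u_1, u_2)  is  tlift f (comul u). *)
Notation tensor U V := ('M_(\dim {:U}, \dim {:V})).

Definition tens (k : fieldType) (U V : vectType k) (u : U) (v : V)
    : tensor U V :=
  \matrix_(i, j) (coord (vbasis {:U}) i u * coord (vbasis {:V}) j v).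

Definition tlift (k : fieldType) (U V : vectType k) (W : lmodType k)
    (f : U -> V -> W) (t : tensor U V) : W :=
  \sum_i \sum_j t i j *: f (vbasis {:U})`_i (vbasis {:V})`_j.

Lemma tlift_tens (k : fieldType) (U V : vectType k) (W : lmodType k)
    (f : U -> V -> W) (u : U) (v : V) :
  (forall y, linear (f^~ y)) -> (forall x, linear (f x)) ->
  tlift f (tens u v) = f u v.
Proof.
move=> fl fr.
pose L y : {linear U -> W} :=
  HB.pack (f^~ y) (GRing.isLinear.Build _ _ _ _ (f^~ y) (fl y)).
pose R x : {linear V -> W} :=
  HB.pack (f x) (GRing.isLinear.Build _ _ _ _ (f x) (fr x)).
transitivity (L v (\sum_i coord (vbasis {:U}) i u *: (vbasis {:U})`_i)); last first.
  by rewrite -(coord_vbasis (memvf u)).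
rewrite linear_sum; apply: eq_bigr => i _; rewrite linearZ /=.
transitivity (coord (vbasis {:U}) i u *: R (vbasis {:U})`_i
    (\sum_j coord (vbasis {:V}) j v *: (vbasis {:V})`_j)); last first.
  by rewrite -(coord_vbasis (memvf v)).
rewrite linear_sum scaler_sumr; apply: eq_bigr => j _.
by rewrite linearZ /= !mxE scalerA.
Qed.

Record hopf_structure (k : fieldType) (H : falgType k) := HopfStructure {
  comul : {linear H -> tensor H H};
  counit : {scalar H};
  antipode : {linear H -> H};
  comulA : forall x,
    tlift (fun x1 x2 => tlift (fun y z => tens y (tens z x2)) (comul x1))
          (comul x)
    = tlift (fun x1 x2 => tens x1 (comul x2)) (comul x);
  counitl : forall x, tlift (fun x1 x2 => counit x1 *: x2) (comul x) = x;
  counitr : forall x, tlift (fun x1 x2 => counit x2 *: x1) (comul x) = x;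
  comul1 : comul 1 = tens 1 1;
  comulM : forall x y,
    comul (x * y)
    = tlift (fun x1 x2 => tlift (fun y1 y2 => tens (x1 * y1) (x2 * y2))
                                (comul y))
            (comul x);
  counit1 : counit 1 = 1;
  counitM : forall x y, counit (x * y) = counit x * counit y;
  antipodel : forall x,
    tlift (fun x1 x2 => antipode x1 * x2) (comul x) = (counit x)%:A;
  antipoder : forall x,
    tlift (fun x1 x2 => x1 * antipode x2) (comul x) = (counit x)%:A
}.

Section PartialActions.
Variables (k : fieldType) (H : falgType k) (h : hopf_structure H).

Definition partial_action (l : {scalar H}) : Prop :=
  l 1 = 1 /\
  forall u v : H,
    l u * l v = tlift (fun u1 u2 => l u1 * l (u2 * v) : k^o) (comul h u).

Definition symmetric_partial_action (l : {scalar H}) : Prop :=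
  partial_action l /\
  forall u v : H,
    l u * l v = tlift (fun u1 u2 => l (u1 * v) * l u2 : k^o) (comul h u).

End PartialActions.

Definition K_relations (k : fieldType) (q : k) (A : algType k) (a b c d : A)
    : Prop :=
  [/\ [/\ a ^+ 4 = 1, a * d = 1 & d * a = 1],
      [/\ b ^+ 2 = 0, c ^+ 2 = 0, b * c = 0 & c * b = 0],
      a ^+ 2 * c = b
    & [/\ a * b = q *: (b * a), a * c = q *: (c * a),
          b * d = q *: (d * b) & c * d = q *: (d * c)]].

(* Presentation by generators and relations, as a universal property. *)
Definition K_presented (k : fieldType) (q : k) (A : algType k) (a b c d : A)
    : Prop :=
  K_relations q a b c d /\
  forall (A' : algType k) (a' b' c' d' : A'),
    K_relations q a' b' c' d' ->
    exists2 f : {lrmorphism A -> A'},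
      [/\ f a = a', f b = b', f c = c' & f d = d']
    & forall g : {lrmorphism A -> A'},
        [/\ g a = a', g b = b', g c = c' & g d = d'] -> g =1 f.

Definition K_basis (k : fieldType) (K : falgType k) (a b c d : K) : 8.-tuple K :=
  [tuple 1; a; b; c; d; a ^+ 2; a * b; a * c].

(* (K, h) is the 8-dimensional Hopf algebra generated by a, b, c, d, with
   q = xi ^+ 2; this determines (K, h) up to isomorphism. *)
Record is_K (k : fieldType) (xi : k) (K : falgType k) (h : hopf_structure K)
    (a b c d : K) : Prop := IsK {
  K_pres : K_presented (xi ^+ 2) a b c d;
  K_basisP : basis_of {:K} (K_basis a b c d);
  K_comul :
    [/\ comul h 1 = tens 1 1,
        comul h (a ^+ 2) = tens (a ^+ 2) (a ^+ 2),
        comul h a = tens a a + tens b c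
      & comul h b = tens b d + tens a b] /\
    [/\ comul h c = tens c a + tens d c,
        comul h d = tens c b + tens d d,
        comul h (a * b) = tens (a * b) 1 + tens (a ^+ 2) (a * b)
      & comul h (a * c) = tens (a * c) (a ^+ 2) + tens 1 (a * c)];
  K_counit :
    [/\ counit h 1 = 1, counit h a = 1, counit h (a ^+ 2) = 1
      & counit h d = 1] /\
    [/\ counit h b = 0, counit h c = 0, counit h (a * b) = 0
      & counit h (a * c) = 0];
  K_antipode :
    [/\ antipode h a = d, antipode h b = xi ^+ 2 *: b,
        antipode h c = - (xi ^+ 2 *: c) & antipode h d = a]
}.

Section Maps.
Variables (k : fieldType) (K : falgType k) (a b c d : K).

(* The linear map K -> k taking the values v on the basis
   1, a, b, c, d, a^2, ab, ac, in this order. *)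
Definition from_values (v : 8.-tuple k) (x : K) : k :=
  \sum_(i < 8) coord (K_basis a b c d) i x * tnth v i.

Lemma from_values_is_scalar v : scalar (from_values v).
Proof.
move=> s x y; rewrite /from_values mulr_sumr -big_split /=.
by apply: eq_bigr => i _; rewrite linearP /= mulrDl mulrA.
Qed.

HB.instance Definition _ v :=
  GRing.isLinear.Build k K k *%R (from_values v) (from_values_is_scalar v).

Definition lambda0 : {scalar K} := from_values [tuple 1; 0; 0; 0; 0; 1; 0; 0].

Definition lambda (alpha : k) : {scalar K} :=
  from_values [tuple 1; 0; 0; 0; 0; 0; alpha; alpha].

Variable xi : k.

Definition sqrt2 : k := 2%:R * xi / (1 + xi ^+ 2).

(* lambda_+ and lambda_- are the cases s = 1 and s = -1. *)
Definition lambda_sign (s : k) : {scalar K} :=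
  let q := xi ^+ 2 in let r := s * (sqrt2 / 2%:R) in
  from_values [tuple 1; (1 - q) / 2%:R; r; r; (1 + q) / 2%:R; 0; r; r].

Definition lambda_plus : {scalar K} := lambda_sign 1.
Definition lambda_minus : {scalar K} := lambda_sign (-1).

End Maps.

(* Main.v *)
(* Both identities are bilinear in (u, v), so they are equations in the values
   x, y, z, w, e, m, n of l on a, b, c, d, a^2, ab, ac. The pair (a^2, a^2)
   gives e^2 = e. If e = 1, then b, c, ab, ac are killed and x = w is
   idempotent: this is the counit or lambda0. If e = 0, then m = n and
   y^2 = y n. If y = 0, then x = z = w = 0, which is lambda_n. If y <> 0, then
   y = z = n, w + x = 1 and w - x = q, so y^2 = x w = 1/2: this is lambda_+ or
   lambda_-. Symmetry is then checked on the basis for each family. *)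
Require Import Defs.
From HB Require Import structures.
From mathcomp Require Import all_boot all_order all_algebra all_field.
From mathcomp Require Import ring.

Set Implicit Arguments.
Unset Strict Implicit.
Unset Printing Implicit Defensive.

Import GRing.Theory.

Local Open Scope ring_scope.

(** * Linear functionals on tensors, and agreement on a basis *)

Section Tensor.
Variables (k : fieldType) (U V : vectType k).

Lemma tlift_is_linear (W : lmodType k) (f : U -> V -> W) : linear (tlift f).
Proof.
move=> s t t'; rewrite /tlift scaler_sumr -big_split; apply: eq_bigr => i _.
rewrite scaler_sumr -big_split; apply: eq_bigr => j _.
by rewrite /= !mxE scalerDl scalerA.
Qed.

Lemma tliftD (W : lmodType k) (f : U -> V -> W) t t' :
  tlift f (t + t') = tlift f t + tlift f t'.
Proof. by rewrite -[t]scale1r tlift_is_linear !scale1r. Qed.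

Lemma tlift_scalar (f : U -> k) (g : V -> k) u v :
  scalar f -> scalar g ->
  tlift (fun x y => f x * g y : k^o) (tens u v) = f u * g v.
Proof.
move=> fl gl; rewrite tlift_tens // => [y s x x'|x s y y'].
  by rewrite fl mulrDl -mulrA.
by rewrite gl mulrDr mulrCA.
Qed.

(** Stated for bare functions with linearity proofs, because it is applied to expressions such as
    [fun v => l u * l v] that carry no bundled structure. *)
Lemma scalar_ext n (X : n.-tuple U) (f g : U -> k) :
  basis_of fullv X -> scalar f -> scalar g ->
  (forall i, f (tnth X i) = g (tnth X i)) -> f =1 g.
Proof.
move=> XP fl gl eqfg x.
pose F : {scalar U} := HB.pack f (GRing.isLinear.Build _ _ _ _ f fl).
pose G : {scalar U} := HB.pack g (GRing.isLinear.Build _ _ _ _ g gl).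
rewrite -[f]/(F : U -> k) -[g]/(G : U -> k).
rewrite (coord_basis XP (memvf x)) !linear_sum; apply: eq_bigr => i _.
by rewrite !linearZ /= -tnth_nth eqfg.
Qed.

End Tensor.

(** The ordinals are explicit so that [tnth] computes on the basis tuple. *)
Lemma forall_I8 (P : 'I_8 -> Prop) :
  (forall i, P i) <->
  [/\ P (@Ordinal 8 0 isT), P (@Ordinal 8 1 isT), P (@Ordinal 8 2 isT)
    & P (@Ordinal 8 3 isT)] /\
  [/\ P (@Ordinal 8 4 isT), P (@Ordinal 8 5 isT), P (@Ordinal 8 6 isT)
    & P (@Ordinal 8 7 isT)].
Proof.
split=> [HP | [[P0 P1 P2 P3] [P4 P5 P6 P7]] [i]]; first by split; split.
move: i.
by do 8![case=> [lt_i|]; first by rewrite (bool_irrelevance lt_i isT)].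
Qed.

(** * The multiplication table of the algebra *)

Section Relations.
Variables (k : fieldType) (q : k) (A : algType k) (a b c d : A).
Hypotheses (q2 : q ^+ 2 = -1) (KR : K_relations q a b c d).

(** Every product of two basis elements other than 1 that is not itself in the basis, packed as one
    rewriting rule. The table rests on [d = a ^+ 3] and on [q] having inverse [- q]. *)
Lemma K_mulE :
  ((a * a = a ^+ 2)%R * (a * d = 1)%R * (a * a ^+ 2 = d)%R *
   (a * (a * b) = c)%R * (a * (a * c) = b)%R * (b * a = - q *: (a * b))%R *
   (b * b = 0)%R * (b * c = 0)%R * (b * d = q *: (a * c))%R *
   (b * a ^+ 2 = - c)%R * (b * (a * b) = 0)%R * (b * (a * c) = 0)%R *
   (c * a = - q *: (a * c))%R * (c * b = 0)%R * (c * c = 0)%R *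
   (c * d = q *: (a * b))%R * (c * a ^+ 2 = - b)%R * (c * (a * b) = 0)%R *
   (c * (a * c) = 0)%R * (d * a = 1)%R * (d * b = a * c)%R *
   (d * c = a * b)%R * (d * d = a ^+ 2)%R * (d * a ^+ 2 = a)%R *
   (d * (a * b) = b)%R * (d * (a * c) = c)%R * (a ^+ 2 * a = d)%R *
   (a ^+ 2 * b = c)%R * (a ^+ 2 * c = b)%R * (a ^+ 2 * d = a)%R *
   (a ^+ 2 * a ^+ 2 = 1)%R * (a ^+ 2 * (a * b) = a * c)%R *
   (a ^+ 2 * (a * c) = a * b)%R * (a * b * a = - q *: c)%R *
   (a * b * b = 0)%R * (a * b * c = 0)%R * (a * b * d = q *: b)%R *
   (a * b * a ^+ 2 = - (a * c))%R * (a * b * (a * b) = 0)%R *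
   (a * b * (a * c) = 0)%R * (a * c * a = - q *: b)%R * (a * c * b = 0)%R *
   (a * c * c = 0)%R * (a * c * d = q *: c)%R *
   (a * c * a ^+ 2 = - (a * b))%R * (a * c * (a * b) = 0)%R *
   (a * c * (a * c) = 0)%R)%type.
Proof.
case: KR => [[a4 ad da] [b2 c2 bc cb] a2c [ab ac bd cd]].
have qq : q * - q = 1 by rewrite mulrN -expr2 q2 opprK.
have ba : b * a = - q *: (a * b) by rewrite ab scalerA mulrC qq scale1r.
have ca : c * a = - q *: (a * c) by rewrite ac scalerA mulrC qq scale1r.
have aa : a * a = a ^+ 2 by rewrite expr2.
have a3 : a ^+ 3 = d by rewrite -[LHS]mulr1 -ad mulrA -exprSr a4 mul1r.
have a2b : a ^+ 2 * b = c by rewrite -a2c mulrA -exprD a4 mul1r.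
have db : d * b = a * c by rewrite -a2c mulrA -a3 -exprD exprS a4 mulr1.
have dc : d * c = a * b by rewrite -a3 -a2c mulrA -exprS.
have bd' : b * d = q *: (a * c) by rewrite bd db.
have cd' : c * d = q *: (a * b) by rewrite cd dc.
(* Each passage of [a] across [b] costs a factor [- q], and [(- q) ^+ 2 = -1]. *)
have ba2 : b * a ^+ 2 = - c.
  by rewrite expr2 mulrA ba -scalerAl -mulrA ba -scalerAr scalerA mulrNN -expr2
             q2 scaleN1r mulrA aa a2b.
have ca2 : c * a ^+ 2 = - b.
  by rewrite expr2 mulrA ca -scalerAl -mulrA ca -scalerAr scalerA mulrNN -expr2
             q2 scaleN1r mulrA aa a2c.
have dd : d * d = a ^+ 2 by rewrite -a3 -exprD -[RHS]mul1r -a4 -exprD.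
have bb : b * b = 0 by rewrite -expr2.
have cc : c * c = 0 by rewrite -expr2.
have aab : a * (a * b) = c by rewrite mulrA aa.
have aac : a * (a * c) = b by rewrite mulrA aa.
have a2ab : a ^+ 2 * (a * b) = a * c by rewrite mulrA -exprSr exprS -mulrA a2b.
have a2ac : a ^+ 2 * (a * c) = a * b by rewrite mulrA -exprSr exprS -mulrA a2c.
have dab : d * (a * b) = b by rewrite mulrA da mul1r.
have dac : d * (a * c) = c by rewrite mulrA da mul1r.
(* Moving [a] to the front leaves a multiple of [a * (x * y)]; this serves for [x] and [y] among [b]
   and [c]. *)
have kill x y : x * y = 0 -> x * a = - q *: (a * x) -> x * (a * y) = 0.
  by move=> xy xa; rewrite mulrA xa -scalerAl -mulrA xy mulr0 scaler0.
do !split => //; rewrite -?[a * _ * _]mulrA ?(kill _ _ bb) ?(kill _ _ bc)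
  ?(kill _ _ cb) ?(kill _ _ cc) // ?ba ?ca ?bd' ?cd' ?ba2 ?ca2 ?bb ?bc ?cb ?cc
  -?scalerAr ?aab ?aac ?mulrN ?mulr0 //.
- by rewrite -a3 -exprD exprS a4 mulr1.
- by rewrite ad mulr1.
Qed.

End Relations.

Section Sweedler.
Variables (k : fieldType) (H : falgType k) (h : hopf_structure H).

(** Covers both defining identities at once. Linearity of [F] is asked only in [v]: in [u] the
    right-hand side is linear because [comul h] and [tlift] are. *)
Lemma sweedler_ext n (X : n.-tuple H) (l : {scalar H}) (F : H -> H -> H -> k) :
  basis_of fullv X -> (forall x y, scalar (fun v => F v x y)) ->
  (forall i j, l (tnth X i) * l (tnth X j)
               = tlift (F (tnth X j) : _ -> _ -> k^o) (comul h (tnth X i))) ->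
  forall u v, l u * l v = tlift (F v : _ -> _ -> k^o) (comul h u).
Proof.
move=> XP Fl eqF u v.
apply: (scalar_ext XP (f := fun v => l u * l v)
                      (g := fun v => tlift (F v : _ -> _ -> k^o) (comul h u))).
- by move=> s x y; rewrite /= linearP mulrDr mulrCA.
- move=> s x y; rewrite /tlift mulr_sumr -big_split; apply: eq_bigr => i _.
  rewrite mulr_sumr -big_split; apply: eq_bigr => j _.
  by rewrite /= Fl /GRing.scale /= mulrDr mulrCA.
move=> j; apply: (scalar_ext XP (f := fun u => l u * l (tnth X j))
  (g := fun u => tlift (F (tnth X j) : _ -> _ -> k^o) (comul h u))) => // s x y.
- by rewrite /= linearP mulrDl mulrA.
- by rewrite /= linearP tlift_is_linear.
Qed.

End Sweedler.

(** * Coproducts, coordinates and reduction to pairs of basis elements *)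

Section PartialActionsOfK.
Variables (k : fieldType) (xi : k) (K : falgType k) (h : hopf_structure K).
Variables (a b c d : K).
Hypotheses (HK : is_K xi h a b c d) (xi4 : xi ^+ 4 = -1).

Let B := K_basis a b c d.
Let q := xi ^+ 2.

Let q2 : q ^+ 2 = -1. Proof. by rewrite -exprM. Qed.
Let mulE := K_mulE q2 (proj1 (K_pres HK)).

(** Taking [l] and [fun x => l (x * v)] for [f] and [g] gives the right-hand side of the partial
    action identity; swapping them gives that of symmetry. *)
Lemma K_comulE (f g : K -> k) (fl : scalar f) (gl : scalar g)
    (F := fun x y : K => f x * g y : k^o) :
  ((tlift F (comul h 1) = f 1 * g 1)%R *
   (tlift F (comul h a) = f a * g a + f b * g c)%R *
   (tlift F (comul h b) = f b * g d + f a * g b)%R *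
   (tlift F (comul h c) = f c * g a + f d * g c)%R *
   (tlift F (comul h d) = f c * g b + f d * g d)%R *
   (tlift F (comul h (a ^+ 2)) = f (a ^+ 2) * g (a ^+ 2))%R *
   (tlift F (comul h (a * b)) = f (a * b) * g 1 + f (a ^+ 2) * g (a * b))%R *
   (tlift F (comul h (a * c)) = f (a * c) * g (a ^+ 2) + f 1 * g (a * c))%R
  )%type.
Proof.
case: (K_comul HK) => [[-> -> -> ->] [-> -> -> ->]].
by rewrite !tliftD !tlift_scalar.
Qed.

Definition K_values (l : K -> k) (v : 8.-tuple k) :=
  forall i, l (tnth B i) = tnth v i.

Lemma from_values_basis v : K_values (from_values a b c d v) v.
Proof.
move=> i; rewrite /from_values (bigD1 i) //= big1 => [|j ji].
  by rewrite (tnth_nth 0) coord_free ?(basis_free (K_basisP HK)) // eqxx mul1r addr0.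
by rewrite (tnth_nth 0) coord_free ?(basis_free (K_basisP HK)) // eq_sym (negPf ji) mul0r.
Qed.

Lemma eq_from_values (l : {scalar K}) v :
  l =1 from_values a b c d v <-> K_values l v.
Proof.
split=> [eql i | eql]; first by rewrite eql from_values_basis.
apply: (scalar_ext (K_basisP HK)); first exact: linearP.
  exact: from_values_is_scalar.
by move=> i; rewrite eql from_values_basis.
Qed.

Lemma eq_from_valuesP (l : {scalar K}) x y z w e m n :
  l =1 from_values a b c d [tuple 1; x; y; z; w; e; m; n] <->
  l 1 = 1 /\ (l a, l b, l c, l d, l (a ^+ 2), l (a * b), l (a * c))
             = (x, y, z, w, e, m, n).
Proof.
rewrite eq_from_values /K_values forall_I8 /tnth /=; split.
  by case=> [[-> -> -> ->] [-> -> -> ->]].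
by case=> -> [-> -> -> -> -> -> ->].
Qed.

Lemma partial_action_basis (l : {scalar K}) :
  l 1 = 1 ->
  (forall i j, l (tnth B i) * l (tnth B j)
     = tlift (fun x y => l x * l (y * tnth B j) : k^o) (comul h (tnth B i))) ->
  partial_action h l.
Proof.
move=> l1 eql; split=> //.
apply: (sweedler_ext (F := fun v x y => l x * l (y * v)) (K_basisP HK)) => //.
by move=> x y s v w; rewrite mulrDr -scalerAr /= linearP mulrDr mulrCA.
Qed.

Lemma symmetric_basis (l : {scalar K}) :
  partial_action h l ->
  (forall i j, l (tnth B i) * l (tnth B j)
     = tlift (fun x y => l (x * tnth B j) * l y : k^o) (comul h (tnth B i))) ->
  symmetric_partial_action h l.
Proof.
move=> pl eql; split=> //.
apply: (sweedler_ext (F := fun v x y => l (x * v) * l y) (K_basisP HK)) => //.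
by move=> x y s v w; rewrite mulrDr -scalerAr /= linearP mulrDl -mulrA.
Qed.

Lemma mulr_scalar (l : {scalar K}) v : scalar (fun x => l (x * v)).
Proof. by move=> s x y; rewrite mulrDl -scalerAl linearP. Qed.

Lemma partial_action_eqs (l : {scalar K}) u v : partial_action h l ->
  l u * l v = tlift (fun x y => l x * l (y * v) : k^o) (comul h u).
Proof. by case. Qed.

Hypothesis two_neq0 : 2%:R != 0 :> k.

(** * Arithmetic with the eighth root of unity *)

Lemma q_neq0 : q != 0.
Proof. by rewrite -sqrf_eq0 q2 oppr_eq0 oner_eq0. Qed.

(** Since [xi ^+ 5 = - xi], the product of [1 + xi ^+ 2] and [xi - xi ^+ 3] is [2%:R * xi]. If the
    denominator vanished, [q = -1] would contradict [q ^+ 2 = -1]. *)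
Lemma sqrt2E : sqrt2 xi = xi - xi ^+ 3.
Proof.
have q1 : 1 + xi ^+ 2 != 0.
  apply/eqP => q1; move: q2; rewrite /q (_ : xi ^+ 2 = -1).
    rewrite sqrrN expr1n => /eqP; rewrite -subr_eq0 opprK -(natrD k 1 1).
    by rewrite (negPf two_neq0).
  by apply/eqP; rewrite -subr_eq0 opprK addrC q1.
by rewrite /sqrt2; field: xi4.
Qed.

Lemma sqr_half_sqrt2 : (sqrt2 xi / 2%:R) ^+ 2 = 1 / 2%:R.
Proof. by rewrite sqrt2E; field: xi4. Qed.

(** In order: the counit, [lambda0], the two maps [lambda_sign] treated together through
    [s ^+ 2 = 1], and the family [lambda]. *)
Definition admissible (x y z w e m n : k) : Prop :=
  [\/ (x, y, z, w, e, m, n) = (1, 0, 0, 1, 1, 0, 0),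
      (x, y, z, w, e, m, n) = (0, 0, 0, 0, 1, 0, 0),
      exists2 s, s ^+ 2 = 1
      & let r := s * (sqrt2 xi / 2%:R) in
        (x, y, z, w, e, m, n) = ((1 - q) / 2%:R, r, r, (1 + q) / 2%:R, 0, r, r)
    | exists alpha, (x, y, z, w, e, m, n) = (0, 0, 0, 0, 0, alpha, alpha)].

Lemma partial_action_admissible (l : {scalar K}) : partial_action h l ->
  admissible (l a) (l b) (l c) (l d) (l (a ^+ 2)) (l (a * b)) (l (a * c)).
Proof.
move=> pl; have l1 : l 1 = 1 by case: pl.
have E u v := partial_action_eqs u v pl.
have C v := K_comulE (linearP l) (mulr_scalar l v).
have simplE := (mulE, mul1r, mulr1, l1, linearZ, linearN, linear0).
(* The first pair makes the value on [a ^+ 2], called [g] below, idempotent. The next five pairs and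
   [(a, a)] settle [g = 1]; the others serve for [g = 0]. *)
have := (E (a ^+ 2) (a ^+ 2), E (a ^+ 2) a, E (a ^+ 2) c, E (a * b) 1,
  E (a * b) a, E (a * c) 1, (E (a * c) a, E (a * c) d, E (a * c) (a ^+ 2)),
  (E a 1, E a a, E a (a ^+ 2)), (E b 1, E b b), E d d).
rewrite !C /= !simplE /= => -[[[[[[[[[]]]]]]]]].
move: (l a) (l b) (l c) (l d) (l (a ^+ 2)) (l (a * b)) (l (a * c)).
move=> x y z w g m n gg gx gz gm gqz gn [[nx nw ng]] [[xE xx xg]] [yE yy] ww.
have q0 := q_neq0; rewrite -/q in q0.
have [g0|g0] := eqVneq g 0; last first.
  have g1 : g = 1 by apply: (mulfI g0); rewrite gg mulr1.
  move: gx gz gm gqz gn xx; rewrite g1 !mul1r mulr1 => xw zy mE zE nE xx.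
  have m0 : m = 0 by apply: (addrI m); rewrite addr0 -mE.
  have n0 : n = 0 by apply: (addIr n); rewrite add0r -nE.
  have z0 : z = 0.
    apply/eqP; have /eqP : - q * z = 0 by apply: (addrI (m * x)); rewrite addr0 -zE.
    by rewrite mulf_eq0 oppr_eq0 (negPf q0).
  have y0 : y = 0 by rewrite -zy.
  have [x0|x0] := eqVneq x 0.
    by constructor 2; rewrite -xw x0 z0 y0 m0 n0.
  have x1 : x = 1 by apply: (mulfI x0); rewrite xE -xE xx y0 mul0r addr0 mulr1.
  by constructor 1; rewrite -xw x1 z0 y0 m0 n0.
move: ng xx xg ww yy; rewrite g0 !mulr0 !add0r !addr0 => /esym/subr0_eq/esym mn xx xw ww yy.
have xwE : x * w = y * y by apply/subr0_eq; rewrite -mulrN -xw.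
have [y0|y0] := eqVneq y 0.
  have z0 : z = 0.
    apply/eqP; have /eqP : q * z = 0.
      by apply: (addrI (n * x)); rewrite -nw nx y0 mulr0 !addr0.
    by rewrite mulf_eq0 (negPf q0).
  have x0 : x = 0 by apply/eqP; move/eqP: xx; rewrite y0 mul0r mulf_eq0 orbb.
  have w0 : w = 0 by apply/eqP; move/eqP: ww; rewrite z0 mul0r mulf_eq0 orbb.
  by constructor 4; exists n; rewrite mn x0 y0 z0 w0.
have yn : y = n by apply: (mulfI y0).
have wx1 : w + x = 1 by apply: (mulfI y0); rewrite mulr1 mulrDr [y * x]mulrC -yE.
(* The pair [(a * c, a)] reads [n * x = n * w - q * y], and here [n = y] is nonzero. With the pair
   [(a * c, d)] it also gives [z = y]. *)
have wx : w - x = q.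
  by apply: (mulfI y0); rewrite mulrBr yn nx -yn; ring.
have zy : z = y.
  apply: (mulfI q0); apply: (addrI (n * x)).
  by rewrite -nw nx; ring.
have xE1 : x = 1 - w by rewrite -wx1; ring.
have wq : w = (1 + q) / 2%:R.
  by apply: (canRL (mulfK two_neq0)); rewrite -wx xE1; ring.
have xq : x = (1 - q) / 2%:R by rewrite xE1 wq; field.
have r2 := sqr_half_sqrt2; set r := sqrt2 xi / _ in r2.
have r0 : r != 0.
  by rewrite -sqrf_eq0 r2 mul1r invr_eq0.
(* Both [y] and [r] are square roots of 1/2, as [y ^+ 2 = x * w = (1 - q ^+ 2) / 4], so their
   quotient is the sign. *)
constructor 3; exists (y / r).
  by rewrite expr_div_n r2 expr2 -xwE xq wq; field: q2; rewrite two_neq0 oner_neq0.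
by rewrite /= -/r divfK // zy mn -yn xq wq.
Qed.

(** The values alone decide the matter, so this is also the converse of the classification: both
    identities are checked on all 64 pairs of basis elements, with [s] and [alpha] symbolic. *)
Lemma admissible_symmetric (l : {scalar K}) : l 1 = 1 ->
  admissible (l a) (l b) (l c) (l d) (l (a ^+ 2)) (l (a * b)) (l (a * c)) ->
  symmetric_partial_action h l.
Proof.
move=> l1 V.
have C v := K_comulE (linearP l) (mulr_scalar l v).
have D v := K_comulE (mulr_scalar l v) (linearP l).
have lZ s x : l (s *: x) = s * l x by rewrite linearZ.
have lN x : l (- x) = - l x by rewrite linearN.
have l0 : l 0 = 0 := linear0 l.
apply: symmetric_basis; first apply: partial_action_basis => //.
all: apply/forall_I8; split; split; apply/forall_I8; split; split.
all: rewrite /tnth /= ?(C, D) {C D}; move: mulE V.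
(* Otherwise the rewriting below would try to unfold a ^+ 2 into a * a. *)
all: move: (a ^+ 2) (a * b) (a * c) => e f g M V.
all: rewrite ?(mul1r, mulr1) ?M ?lZ ?lN ?l0 ?l1.
all: move: (l a) (l b) (l c) (l d) (l e) (l f) (l g) V => x y z w ? m n.
all: case=> [||[s s2]|[alpha]] [xE yE zE wE eE mE nE] {M};
  rewrite ?(xE, yE, zE, wE, eE, mE, nE) ?sqrt2E /q.
all: try ring.
(* Only goals of the sign case remain; they hold modulo [s ^+ 2 = 1] and [xi ^+ 4 = -1]. *)
all: by field: s2 xi4.
Qed.

End PartialActionsOfK.

Theorem proposition4p2 (k : closedFieldType) (char0 : [pchar k] =i pred0)
    (xi : k) (xi_prim : 8.-primitive_root xi)
    (K : falgType k) (h : hopf_structure K) (a b c d : K)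
    (HK : is_K xi h a b c d) :
  (forall l : {scalar K},
      partial_action h l <->
      l =1 counit h \/ l =1 lambda0 a b c d \/
      l =1 lambda_plus a b c d xi \/ l =1 lambda_minus a b c d xi \/
      (exists alpha : k, l =1 lambda a b c d alpha)) /\
  (forall l : {scalar K},
      partial_action h l -> symmetric_partial_action h l).
Proof.
have two_neq0 : 2%:R != 0 :> k.
  by have := char0 2; rewrite !inE /= => /negbT.
have xi4 : xi ^+ 4 = -1.
  (* So [xi ^+ 4] is 1 or -1, and 1 is excluded because 8 does not divide 4. *)
  have /eqP : (xi ^+ 4) ^+ 2 = 1 by rewrite -exprM (prim_expr_order xi_prim).
  by rewrite sqrf_eq1 -(prim_order_dvd xi_prim) /= => /eqP.
have counitE : counit h =1 from_values a b c d [tuple 1; 1; 0; 0; 1; 1; 0; 0].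
  apply/(eq_from_valuesP HK).
  by case: (K_counit HK) => [[-> -> -> ->] [-> -> -> ->]].
have eq_counit (l : {scalar K}) : l =1 counit h <->
    l =1 from_values a b c d [tuple 1; 1; 0; 0; 1; 1; 0; 0].
  by split=> eql x; rewrite eql counitE.
have sym_of_values (l : {scalar K}) x y z w e m n :
    l =1 from_values a b c d [tuple 1; x; y; z; w; e; m; n] ->
    admissible xi x y z w e m n -> symmetric_partial_action h l.
  by move=> /(eq_from_valuesP HK)[l1 [<- <- <- <- <- <- <-]];
     apply: (admissible_symmetric HK xi4 two_neq0).
(* Symmetry includes being a partial action, so this serves both the converse of the classification
   and the final claim. *)
have sufficient (l : {scalar K}) :
    l =1 counit h \/ l =1 lambda0 a b c d \/
    l =1 lambda_plus a b c d xi \/ l =1 lambda_minus a b c d xi \/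
    (exists alpha : k, l =1 lambda a b c d alpha) ->
    symmetric_partial_action h l.
  case=> [/eq_counit|[|[|[|[alpha]]]]] /sym_of_values; apply.
  - by constructor 1.
  - by constructor 2.
  - by constructor 3; exists 1; rewrite ?expr1n.
  - by constructor 3; exists (-1); rewrite ?sqrrN ?expr1n.
  - by constructor 4; exists alpha.
have necessary (l : {scalar K}) : partial_action h l ->
    l =1 counit h \/ l =1 lambda0 a b c d \/
    l =1 lambda_plus a b c d xi \/ l =1 lambda_minus a b c d xi \/
    (exists alpha : k, l =1 lambda a b c d alpha).
  move=> pl; have l1 : l 1 = 1 by case: pl.
  case: (partial_action_admissible HK xi4 two_neq0 pl) => [V|V|[s s2 V]|[alpha V]].
  - by left; apply/eq_counit/(eq_from_valuesP HK).
  - by right; left; apply/(eq_from_valuesP HK).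
  - move/eqP: s2; rewrite sqrf_eq1 => /orP[] /eqP sE; rewrite sE in V.
      by do 2!right; left; apply/(eq_from_valuesP HK).
    by do 3!right; left; apply/(eq_from_valuesP HK).
  - by do 4!right; exists alpha; apply/(eq_from_valuesP HK).
split=> l; last by move/necessary/sufficient.
by split=> [/necessary|/sufficient[]].
Qed.
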